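(* Let $m\ge2$ be an integer, let $r\ge2$, and let $n_1,\dots,n_r\in\mathbb N$ be distinct. Let $$X^{(m)}_{n_1,\dots,n_r}:=\{(x_k)_{k=1}^\infty\in\Sigma_m:\ x_{kn_1}x_{kn_2}\cdots x_{kn_r}=0\ \text{ for all } k\in\mathbb N\}.$$ Then $$\dim_H(X^{(m)}_{n_1,\dots,n_r})<\dim_M(X^{(m)}_{n_1,\dots,n_r}).$$
   Context: $\mathbb N=\{1,2,\dots\}$ and $\Sigma_m=\{0,\dots,m-1\}^{\mathbb N}$; the product $x_{kn_1}\cdots x_{kn_r}$ is the ordinary product of integers. $\dim_H$ and $\dim_M$ denote Hausdorff and Minkowski (box) dimension with respect to the metric $\varrho(x,y)=m^{-\min\{n:\,x_n\ne y_n\}}$ on $\Sigma_m$ (with $\varrho(x,x)=0$). *)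

(* Defs.v *)
From HB Require Import structures.
From mathcomp Require Import all_boot all_order all_algebra.
From mathcomp Require Import all_classical all_reals all_analysis.

Set Implicit Arguments.
Unset Strict Implicit.
Unset Printing Implicit Defensive.

Import Order.TTheory GRing.Theory Num.Theory.
Import numFieldNormedType.Exports.

Local Open Scope classical_set_scope.
Local Open Scope ring_scope.

Section Dimensions.
Context {R : realType} {T : metricType R}.
Implicit Types (A U : set T) (s delta eps : R).

(* The supremum is taken in \bar R, so diam set0 = -oo: the empty set is
   admitted in a cover at every scale. *)
Definition diam U : \bar R :=
  ereal_sup [set (mdist p.1 p.2)%:E | p in U `*` U].

(* The usual conventions: diam(set0)^s = 0 for all s, including s = 0, while
   diam(U)^0 = 1 for U nonempty. *)
Definition diam_pow s U : \bar R :=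
  if U == set0 then 0%E else poweR (diam U) s.

Definition hausdorff_content s delta A : \bar R :=
  ereal_inf [set (\sum_(0 <= i <oo) diam_pow s (U i))%E |
    U in [set U : nat -> set T |
      A `<=` \bigcup_i U i /\ forall i, (diam (U i) <= delta%:E)%E]].

(* The content is nonincreasing in delta, so its limit as delta -> 0+ is a
   supremum. *)
Definition hausdorff_measure s A : \bar R :=
  ereal_sup [set hausdorff_content s delta A | delta in [set delta | 0 < delta]].

Definition hausdorff_dim A : \bar R :=
  ereal_inf [set s%:E |
    s in [set s | 0 <= s /\ hausdorff_measure s A = 0%E]].

(* +oo if A has no finite cover by sets of diameter at most eps. *)
Definition covering_number A eps : \bar R :=
  ereal_inf [set (N%:R)%:E | N in [set N : nat |
    exists U : 'I_N -> set T,
      A `<=` \bigcup_i U i /\ forall i, (diam (U i) <= eps%:E)%E]].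

Definition minkowski_ratio A eps : \bar R :=
  (lne (covering_number A eps) * ((ln eps^-1)^-1)%:E)%E.

Definition has_minkowski_dim A : Prop :=
  cvg (minkowski_ratio A eps @[eps --> 0^'+]).

(* Meaningful only when [has_minkowski_dim A] holds. *)
Definition minkowski_dim A : \bar R :=
  lim (minkowski_ratio A eps @[eps --> 0^'+]).

End Dimensions.

(* A sequence (x_k)_{k >= 1} is stored with its indices shifted by one; always
   read it through [entry].  The argument R is the field in which the distance
   takes its values: it lets the metric be inferred from the type. *)
Definition Sigma (R : realType) (m : nat) : Type := nat -> 'I_m.

Definition entry (R : realType) (m : nat) (x : Sigma R m) (k : nat) : 'I_m :=
  x k.-1.

Section SigmaMetric.
Context {R : realType} {m : nat}.
Implicit Types x y z : Sigma R m.

HB.instance Definition _ := Choice.copy (Sigma R m) (nat -> 'I_m).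

Definition differ_at x y : pred nat :=
  fun n => (0 < n)%N && (entry x n != entry y n).

Lemma ex_differ_at x y : x <> y -> exists n, differ_at x y n.
Proof.
move=> xy; apply: contra_notP xy => h; apply/funext => k.
apply/eqP/negPn/negP => hk; apply: h; exists k.+1.
by rewrite /differ_at /entry.
Qed.

Definition Sigma_dist x y : R :=
  if pselect (x = y) is right xy
  then m%:R ^- ex_minn (ex_differ_at xy) else 0.

Lemma Sigma_distxx x : Sigma_dist x x = 0.
Proof. by rewrite /Sigma_dist; case: pselect. Qed.

Lemma Sigma_m_gt0 x : (0 < m)%N.
Proof. by case: m x => // x; case: (x 0%N). Qed.

Lemma Sigma_dist_ge0 x y : 0 <= Sigma_dist x y.
Proof.
by rewrite /Sigma_dist; case: pselect => // ?; rewrite invr_ge0 exprn_ge0.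
Qed.

Lemma Sigma_dist_positivity x y : Sigma_dist x y = 0 -> x = y.
Proof.
have m0 : m != 0%N by rewrite -lt0n (Sigma_m_gt0 x).
rewrite /Sigma_dist; case: pselect => // xy /eqP.
by rewrite invr_eq0 expf_eq0 pnatr_eq0 (negbTE m0) andbF.
Qed.

Lemma differ_at_sym x y : differ_at x y =1 differ_at y x.
Proof. by move=> n; rewrite /differ_at eq_sym. Qed.

Lemma Sigma_dist_sym x y : Sigma_dist x y = Sigma_dist y x.
Proof.
rewrite /Sigma_dist; case: pselect => [e|xy]; case: pselect => [e'|yx] //.
- by case: yx.
- by case: xy.
by congr (_ ^- _); apply: eq_ex_minn; exact: differ_at_sym.
Qed.

Lemma Sigma_dist_le x y n : differ_at x y n -> m%:R ^- n <= Sigma_dist x y.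
Proof.
move=> dn; rewrite /Sigma_dist; case: pselect => [e|xy].
  by move: dn; rewrite /differ_at e eqxx andbF.
case: ex_minnP => k _ /(_ _ dn) kn.
have m0 : 0 < m%:R :> R by rewrite ltr0n (Sigma_m_gt0 x).
by rewrite lef_pV2 ?posrE ?exprn_gt0// ler_weXn2l// ler1n (Sigma_m_gt0 x).
Qed.

Lemma Sigma_dist_triangle y x z :
  Sigma_dist x z <= Sigma_dist x y + Sigma_dist y z.
Proof.
rewrite {1}/Sigma_dist; case: pselect => [_|xz].
  by rewrite addr_ge0// Sigma_dist_ge0.
case: ex_minnP => n /andP[n0 xzn] _.
have [xyn|xyn] := eqVneq (entry x n) (entry y n).
  apply: ler_wpDl; first exact: Sigma_dist_ge0.
  by apply: Sigma_dist_le; rewrite /differ_at n0 -xyn.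
apply: ler_wpDr; first exact: Sigma_dist_ge0.
by apply: Sigma_dist_le; rewrite /differ_at n0.
Qed.

HB.instance Definition _ := @isMetric.Build R (Sigma R m) Sigma_dist
  Sigma_distxx Sigma_dist_positivity Sigma_dist_sym Sigma_dist_triangle.

End SigmaMetric.

Definition mult_shift (R : realType) (m r : nat) (n : 'I_r -> nat) :
    set (Sigma R m) :=
  [set x | forall k : nat, (0 < k)%N ->
    (\prod_(i < r) (entry x (k * n i) : nat))%N = 0%N].

Arguments mult_shift R m {r} n.

(* Main.v *)
Require Import Defs.
From mathcomp Require Import all_boot all_order all_algebra.
From mathcomp Require Import all_classical all_reals all_analysis.
From mathcomp Require Import zify ring lra.

Set Implicit Arguments.
Unset Strict Implicit.
Unset Printing Implicit Defensive.

Import Order.TTheory GRing.Theory Num.Theory.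
Import numFieldNormedType.Exports.

Local Open Scope classical_set_scope.
Local Open Scope ring_scope.

(** Write [M] for the largest of the [n j], [Q] for their product, and [A N] for
    the number of prefixes of length [N] of points of the set.  A zero never
    violates a constraint, so cutting a point after [N] places and padding it
    with zeros stays inside the set: the prefixes are exactly the words whose
    zero padding satisfies all constraints.

    Minkowski dimension.  Sets of diameter less than [m ^- N] lie in cylinders
    of length [N], so the box dimension exists as soon as [ln (A N) / N]
    converges.  Call an integer smooth if all its prime factors divide [Q].  A
    constraint only involves places with one and the same [Q]-coprime part [i],
    that is, places of the form [i * s] with [s] smooth, and the constraints on
    such a class look the same for every [i].  Exchanging a class between two
    words shows that [A p / A p.-1] depends only on the smooth part of [p]
    ([card_words_exchange]).  So [ln (A N) / N] is the average over [p <= N] of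
    a bounded function of the smooth part of [p]; up to a set of small density
    such a function is periodic modulo a power of [Q], whence it has a mean
    value ([cvg_mean_of_part]).

    Strict inequality.  Fix a large [h] and look at indices [i] coprime to [Q]
    in a window just below [h], at the two lengths [(M - 1) * h] and [M * h].
    Call [i] forcing in [x] if [x] is nonzero at all [i * n j] with [n j < M].
    At the shorter length the place [i * M] is not reached, the block of places
    [i * n j] is unconstrained, and a fraction [p] of the blocks is forcing.  At
    the longer length the constraint of [i] is active: a forcing block has one
    continuation, zero, while any other block has [m] of them, so forcing blocks
    have a smaller fraction [q].  But forcing does not depend on the length: in
    a given [x] the forcing indices of the window have one frequency, and it
    cannot be close to both [p] and [q].  Hence every [x] has an exponentially
    atypical prefix at one of the two lengths.  In [exists_thin_words] this is
    made quantitative by likelihood weights on the blocks, whose mean is the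
    Bhattacharyya coefficient of [p] and [q], less than one.  As both lengths
    are comparable to the size of the window, the set is covered by exponentially
    fewer cylinders than there are prefixes ([exists_thin_covers]), so the
    Hausdorff measure vanishes for some exponent below the box dimension. *)

(** * Finite words and their padding by zeros *)

Lemma leq_card_map (S T : finType) (A : {set S}) (B : {set T}) (f : S -> T) :
  {in A &, injective f} -> (forall x, x \in A -> f x \in B) -> (#|A| <= #|B|)%N.
Proof.
move=> fI fAB; rewrite -(card_in_imset fI); 
apply/subset_leq_card/fintype.subsetP => y.
by move=> /imsetP[x xA ->]; exact: fAB.
Qed.

Section Words.
Context {R : realType} {m : nat}.
Local Notation T := (Sigma R m.+1).
Implicit Types (x y : T) (N p : nat).

(** The shift by one between indices and storage is confined to this
    constructor; value [f 0] is discarded. *)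
Definition of_entries (f : nat -> 'I_m.+1) : T := fun k => f k.+1.

Lemma entry_of_entries f p : (0 < p)%N -> entry (of_entries f) p = f p.
Proof. by case: p. Qed.

Lemma eq_from_entry x y :
  (forall p, (0 < p)%N -> entry x p = entry y p) -> x = y.
Proof. by move=> xy; apply/funext => k; exact: (xy k.+1). Qed.

Definition zero_after N x := forall p, (N < p)%N -> entry x p = ord0.

Definition pad N (w : {ffun 'I_N -> 'I_m.+1}) : T :=
  fun k => oapp w ord0 (insub k).

Definition start N x : {ffun 'I_N -> 'I_m.+1} := [ffun k : 'I_N => x k].

Lemma padK N : cancel (@pad N) (@start N).
Proof.
move=> w; apply/ffunP => k; rewrite ffunE /pad insubT //= => ?.
by congr (w _); exact: val_inj.
Qed.

Lemma entry_pad_start N x p :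
  (0 < p)%N ->
  entry (pad (start N x)) p = if (p <= N)%N then entry x p else ord0.
Proof.
case: p => // p _; rewrite /entry /= /pad; case: insubP => [k pN kp|].
  by rewrite /= ffunE kp pN.
by rewrite -leqNgt ltnNge => ->.
Qed.

Lemma zero_after_pad N (w : {ffun 'I_N -> 'I_m.+1}) : zero_after N (pad w).
Proof. by case=> // p Np; rewrite /entry /pad /= insubF// ltnNge -ltnS Np. Qed.

Lemma startK N x : zero_after N x -> pad (start N x) = x.
Proof.
move=> x0; apply: eq_from_entry => p p0; rewrite entry_pad_start//.
by case: leqP => // /x0.
Qed.

Context {r : nat} (n : 'I_r -> nat).

Lemma mult_shiftP x : mult_shift R m.+1 n x <->
  forall k, (0 < k)%N -> exists j, entry x (k * n j) = ord0.
Proof.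
split=> h k /h.
  move=> /eqP; rewrite prod_nat_seq_eq0 => /hasP[j _ /= /eqP xj].
  by exists j; apply: val_inj.
by move=> [j xj]; rewrite (bigD1 j)//= xj mul0n.
Qed.

Definition words N : {set {ffun 'I_N -> 'I_m.+1}} :=
  [set w | `[<mult_shift R m.+1 n (pad w)>]].

Lemma wordsP N w : reflect (mult_shift R m.+1 n (pad w)) (w \in words N).
Proof. by rewrite inE; exact: asboolP. Qed.

Lemma start_words N x : zero_after N x -> mult_shift R m.+1 n x ->
  start N x \in words N.
Proof. by move=> x0 Xx; apply/wordsP; rewrite startK. Qed.

Hypothesis n_pos : forall i, (0 < n i)%N.

(** Truncation replaces entries by zeros, which can only help a constraint. *)
Lemma mult_shift_pad_start N x : mult_shift R m.+1 n x ->
  mult_shift R m.+1 n (pad (start N x)).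
Proof.
move=> /mult_shiftP Xx; apply/mult_shiftP => k k0; have [j xj] := Xx _ k0.
by exists j; rewrite entry_pad_start ?muln_gt0 ?k0 ?n_pos// xj if_same.
Qed.

Hypothesis r_gt0 : (0 < r)%N.

Lemma card_words_gt0 N : (0 < #|words N|)%N.
Proof.
apply/card_gt0P; exists [ffun => ord0]; apply/wordsP/mult_shiftP => k _.
exists (Ordinal r_gt0); rewrite /entry /pad.
by case: insub => //= a; rewrite ffunE.
Qed.

Lemma leq_card_words N : (#|words N| <= #|words N.+1|)%N.
Proof.
have z (w : {ffun 'I_N -> 'I_m.+1}) : zero_after N.+1 (pad w).
  by move=> p Np; apply: zero_after_pad; exact: ltnW.
apply: (@leq_card_map _ _ _ _ (fun w => start N.+1 (pad w))) => [w1 w2 _ _|w].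
  by move=> /(congr1 (@pad _)); rewrite !startK// => /(can_inj (@padK N)).
by move=> /wordsP; exact: start_words.
Qed.

Lemma card_wordsS_leq N : (#|words N.+1| <= #|words N| * m.+1)%N.
Proof.
rewrite -[X in (_ <= _ * X)%N]card_ord -cardsT -cardsX.
apply: (@leq_card_map _ _ _ _ (fun w => (start N (pad w), w ord_max))).
  move=> w1 w2 _ _ [] w12 w12N; apply/ffunP => k.
  have [->//|] := eqVneq k ord_max; move=> kN.
  have kltN : (k < N)%N.
    rewrite ltn_neqAle -ltnS ltn_ord andbT; apply: contra kN => /eqP kN.
    exact/eqP/val_inj.
  have /ffunP/(_ (Ordinal kltN)) := w12; rewrite !ffunE /pad/= insubT// => ?.
  by rewrite /oapp; congr (w1 _ = w2 _); apply: val_inj.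
move=> w /wordsP Xw; rewrite finset.in_setX finset.in_setT andbT.
by apply/wordsP; exact: mult_shift_pad_start.
Qed.

End Words.

(** * Exchanging a multiplicative class between two words *)

Section ClassSwap.
Context {R : realType} {m r : nat} (n : 'I_r -> nat).
Hypothesis n_pos : forall i, (0 < n i)%N.
Local Notation T := (Sigma R m.+1).
Local Notation Q := (\prod_j n j)%N.
Local Notation X := (mult_shift R m.+1 n).
Implicit Types (x y : T) (i p q : nat).

Lemma prod_n_gt0 : (0 < Q)%N.
Proof. by rewrite prodn_gt0. Qed.

Lemma dvdn_prod_n j : (n j %| Q)%N.
Proof. by rewrite (bigD1 j)//= dvdn_mulr. Qed.

(** For [i] coprime to [Q] these are the places with [Q]-coprime part [i];
    [in_class 1] is the set of smooth integers. *)
Definition in_class i p := (i %| p)%N && \pi(Q).-nat (p %/ i)%N.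

Lemma in_classM i s : (0 < i)%N -> in_class i (i * s) = \pi(Q).-nat s.
Proof. by move=> i0; rewrite /in_class dvdn_mulr// mulKn. Qed.

(** Constraints do not cross classes: [k * n j] lies in the class of [k]. *)
Lemma in_class_mul i k j : (0 < i)%N -> coprime i Q -> (0 < k)%N ->
  in_class i (k * n j) = in_class i k.
Proof.
move=> i0 iQ k0.
have inj : coprime i (n j) by apply: coprime_dvdr iQ; exact: dvdn_prod_n.
rewrite [RHS]/in_class; case: (boolP (i %| k)%N) => [|ik]; last first.
  by rewrite /in_class Gauss_dvdl// (negbTE ik).
move=> /dvdnP[s ->]; rewrite mulnK// (mulnC s) -mulnA in_classM// pnatM.
by rewrite andbC (pnat_dvd (dvdn_prod_n j)) ?pnat_pi ?prod_n_gt0.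
Qed.

(** [give_class] and [take_class] are the two results of one exchange: the class
    of [i] in [x] and the smooth places of [y] trade their entries along
    [s |-> i * s]. *)
Definition give_class i x y : T :=
  of_entries (fun p => if in_class i p then entry y (p %/ i) else entry x p).

Definition take_class i x y : T :=
  of_entries (fun s => if in_class 1 s then entry x (i * s) else entry y s).

Section Fixed_i.
Variable i : nat.
Hypotheses (i_gt0 : (0 < i)%N) (iQ : coprime i Q).

Lemma divn_gt0_class p : (0 < p)%N -> in_class i p -> (0 < p %/ i)%N.
Proof. by move=> p0 /andP[ip _]; rewrite divn_gt0// dvdn_leq. Qed.

Lemma give_classK x y : give_class i (give_class i x y) (take_class i x y) = x.
Proof.
apply: eq_from_entry => p p0; rewrite entry_of_entries//.
case: ifPn => [pc|pc]; last by rewrite entry_of_entries// (negbTE pc).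
rewrite entry_of_entries ?divn_gt0_class//.
have /andP[ip pip] := pc.
by rewrite /in_class dvd1n divn1 pip mulnC divnK.
Qed.

Lemma take_classK x y : take_class i (give_class i x y) (take_class i x y) = y.
Proof.
apply: eq_from_entry => p p0; rewrite entry_of_entries//.
rewrite /in_class dvd1n divn1/=.
case: ifPn => [pc|pc]; last first.
  by rewrite entry_of_entries// /in_class dvd1n divn1/= (negbTE pc).
by rewrite entry_of_entries ?muln_gt0 ?i_gt0// in_classM// pc mulKn.
Qed.

Lemma give_class_mult_shift x y : X x -> X y -> X (give_class i x y).
Proof.
move=> /mult_shiftP Xx /mult_shiftP Xy; apply/mult_shiftP => k k0.
case: (boolP (in_class i k)) => kc; last first.
  have [j xj] := Xx _ k0; exists j.
  by rewrite entry_of_entries ?muln_gt0 ?k0 ?n_pos// in_class_mul// (negbTE kc).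
have [j yj] := Xy _ (divn_gt0_class k0 kc); exists j.
rewrite entry_of_entries ?muln_gt0 ?k0 ?n_pos// in_class_mul// kc.
have /andP[/dvdnP[s ks] _] := kc.
by rewrite ks -mulnA mulnC -mulnA mulKn// mulnC -[RHS]yj ks mulnK.
Qed.

Lemma take_class_mult_shift x y : X x -> X y -> X (take_class i x y).
Proof.
move=> /mult_shiftP Xx /mult_shiftP Xy; apply/mult_shiftP => k k0.
case: (boolP (in_class 1 k)) => kc; last first.
  have [j yj] := Xy _ k0; exists j.
  rewrite entry_of_entries ?muln_gt0 ?k0 ?n_pos// in_class_mul ?coprime1n//.
  by rewrite (negbTE kc).
have [|j xj] := Xx (i * k)%N; first by rewrite muln_gt0 i_gt0.
exists j; rewrite entry_of_entries ?muln_gt0 ?k0 ?n_pos//.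
by rewrite in_class_mul ?coprime1n// kc mulnA.
Qed.

Section Fixed_q.
Variable q : nat.
Hypotheses (q_gt0 : (0 < q)%N) (q_nat : \pi(Q).-nat q).

Lemma give_class_drop x y : zero_after (i * q) x -> zero_after q.-1 y ->
  zero_after (i * q).-1 (give_class i x y).
Proof.
move=> x0 y0 p; rewrite prednK ?muln_gt0 ?i_gt0// => pq.
have p0 : (0 < p)%N by apply: leq_trans pq; rewrite muln_gt0 i_gt0.
rewrite entry_of_entries//; case: ifPn => pc.
  by apply: y0; rewrite prednK// leq_divRL// mulnC.
apply: x0; rewrite ltn_neqAle pq andbT; apply: contra pc => /eqP <-.
by rewrite in_classM.
Qed.

Lemma take_class_keep x y : zero_after (i * q) x -> zero_after q.-1 y ->
  zero_after q (take_class i x y).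
Proof.
move=> x0 y0 p pq; rewrite entry_of_entries; last exact: leq_trans pq.
case: ifPn => _; first by apply: x0; rewrite ltn_mul2l i_gt0.
by apply: y0; rewrite prednK// ltnW.
Qed.

Lemma give_class_keep x y : zero_after (i * q).-1 x -> zero_after q y ->
  zero_after (i * q) (give_class i x y).
Proof.
move=> x0 y0 p pq; rewrite entry_of_entries; last exact: leq_trans pq.
case: ifPn => [/andP[ip _]|_]; first by apply: y0; rewrite ltn_divRL// mulnC.
by apply: x0; rewrite prednK ?muln_gt0 ?i_gt0// ltnW.
Qed.

Lemma take_class_drop x y : zero_after (i * q).-1 x -> zero_after q y ->
  zero_after q.-1 (take_class i x y).
Proof.
move=> x0 y0 p; rewrite prednK// => pq.
have p0 : (0 < p)%N by exact: leq_trans pq.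
rewrite entry_of_entries//; case: ifPn => pc.
  by apply: x0; rewrite prednK ?muln_gt0 ?i_gt0// leq_mul2l pq orbT.
apply: y0; rewrite ltn_neqAle pq andbT; apply: contra pc => /eqP <-.
by rewrite -[q]mul1n in_classM.
Qed.

Local Notation W := (words (R := R) (m := m) n).

(** The exchange moves the last place [i * q] of the first word to the last
    place [q] of the second one, so one word gets shorter and the other longer.
    Read as an equality of quotients, this says that the effect on the number of
    words of admitting one more place depends only on the smooth part of that
    place. *)
Lemma card_words_exchange :
  (#|W (i * q)| * #|W q.-1| = #|W (i * q).-1| * #|W q|)%N.
Proof.
pose swap a b c d (wv : {ffun 'I_a -> 'I_m.+1} * {ffun 'I_b -> 'I_m.+1}) :=
  (start c (give_class i (pad wv.1 : T) (pad wv.2)),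
   start d (take_class i (pad wv.1 : T) (pad wv.2))).
have swapK a b c d wv : (forall x y, zero_after a x -> zero_after b y ->
      zero_after c (give_class i x y) /\ zero_after d (take_class i x y)) ->
    swap c d a b (swap a b c d wv) = wv.
  case: wv => w v /(_ _ _ (zero_after_pad (R := R) w) (zero_after_pad v))[z1 z2].
  by rewrite /swap /= !startK// give_classK take_classK !padK.
have exchange_leq a b c d : (forall x y, zero_after a x -> zero_after b y ->
      zero_after c (give_class i x y) /\ zero_after d (take_class i x y)) ->
    (forall x y, zero_after c x -> zero_after d y ->
      zero_after a (give_class i x y) /\ zero_after b (take_class i x y)) ->
    (#|W a| * #|W b| <= #|W c| * #|W d|)%N.
  move=> abcd cdab; rewrite -!cardsX; apply: (leq_card_map (f := swap a b c d)).
    move=> u v _ _ uv; rewrite -(swapK a b c d u) ?uv; first exact: swapK.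
    exact: abcd.
  case=> w v; rewrite !finset.in_setX => /andP[/wordsP Xw /wordsP Xv].
  have [z1 z2] := abcd _ _ (zero_after_pad (R := R) w) (zero_after_pad v).
  apply/andP; split; apply: start_words => //.
    exact: give_class_mult_shift.
  exact: take_class_mult_shift.
have shorten x y : zero_after (i * q) x -> zero_after q.-1 y ->
    zero_after (i * q).-1 (give_class i x y) /\ zero_after q (take_class i x y).
  by split; [exact: give_class_drop|exact: take_class_keep].
have lengthen x y : zero_after (i * q).-1 x -> zero_after q y ->
    zero_after (i * q) (give_class i x y) /\ zero_after q.-1 (take_class i x y).
  by split; [exact: give_class_keep|exact: take_class_drop].
by apply/eqP; rewrite eqn_leq !exchange_leq.
Qed.

End Fixed_q.
End Fixed_i.
End ClassSwap.

(** * Mean values of functions of the smooth part *)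

Section MeanValue.
Context {R : realType}.

Lemma sum_dvdn d N : (0 < d)%N -> (\sum_(p < N) (d %| p.+1) = N %/ d)%N.
Proof.
move=> d0; elim: N => [|N IH]; first by rewrite big_ord0 div0n.
by rewrite big_ord_recr/= IH divnS// addnC.
Qed.

(** The places [p] whose smooth part is not determined by [p] modulo [Q ^ e]. *)
Definition divisible_by_high_power (Q e p : nat) :=
  has (fun q => q ^ e %| p)%N (primes Q).

Lemma size_primes_leq Q : (size (primes Q) <= Q)%N.
Proof.
rewrite -[leqRHS](size_iota 1); apply: uniq_leq_size; first exact: primes_uniq.
move=> q; rewrite mem_primes mem_iota => /and3P[/prime_gt0 -> Q0 qQ].
by rewrite add1n ltnS dvdn_leq.
Qed.

(** The multiples of [q ^ e] have density [q ^- e <= 2 ^- e], and at most [Q]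
    primes [q] occur.  The bound is kept free of division. *)
Lemma sum_high_power_leq Q e N :
  ((\sum_(p < N) divisible_by_high_power Q e p.+1) * 2 ^ e <= Q * N)%N.
Proof.
apply: (@leq_trans ((\sum_(q <- primes Q) N %/ q ^ e) * 2 ^ e)).
  rewrite leq_mul2r; apply/orP; right.
  apply: (@leq_trans (\sum_(p < N) \sum_(q <- primes Q) (q ^ e %| p.+1))).
    apply: leq_sum => p _; rewrite /divisible_by_high_power.
    elim: (primes Q) => [//|q s IH]; rewrite big_cons /=.
    by case: (_ %| _)%N.
  rewrite exchange_big/= big_seq [leqRHS]big_seq; apply: leq_sum => q.
  by rewrite mem_primes => /andP[/prime_gt0 q0 _]; rewrite sum_dvdn// expn_gt0 q0.
rewrite big_distrl/=; apply: (@leq_trans (\sum_(q <- primes Q) N)%N).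
  rewrite big_seq [leqRHS]big_seq; apply: leq_sum => q.
  rewrite mem_primes => /andP[/prime_gt1 q1 _].
  apply: leq_trans (leq_divM N (q ^ e)); rewrite leq_mul2l; apply/orP; right.
  by case: e => // e; rewrite leq_exp2r.
rewrite big_const_seq count_predT iter_addn_0 mulnC leq_mul2r.
by rewrite size_primes_leq orbT.
Qed.

(** If no prime of [Q] reaches exponent [e] in [p], its exponents in [p] are
    already visible modulo [Q ^ e]. *)
Lemma partn_add_mul Q e j p : (0 < p)%N -> ~~ divisible_by_high_power Q e p ->
  ((j * Q ^ e + p)`_(\pi(Q)) = p`_(\pi(Q)))%N.
Proof.
move=> p0 /hasPn pe; apply: eq_partn_from_log; rewrite ?addn_gt0 ?p0 ?orbT// => q.
rewrite inE/= => qQ; have qp : prime q by move: qQ; rewrite mem_primes => /andP[].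
have jp0 : (0 < j * Q ^ e + p)%N by rewrite addn_gt0 p0 orbT.
have := pe _ qQ; rewrite pfactor_dvdn// -ltnNge => lt.
have dv v : (v <= e)%N -> (v <= logn q (j * Q ^ e + p))%N = (v <= logn q p)%N.
  move=> ve; rewrite -!pfactor_dvdn// dvdn_addr// dvdn_mull//.
  apply: dvdn_trans (dvdn_exp2l q ve) _; apply: dvdn_exp2r.
  by move: qQ; rewrite mem_primes => /and3P[].
apply/eqP; rewrite eqn_leq dv ?leqnn ?(ltnW lt)// andbT.
by rewrite leqNgt dv// -leqNgt.
Qed.

Variables (r : nat -> R) (C : R) (Q : nat).
Hypotheses (Q_gt0 : (0 < Q)%N) (r_ge0 : forall p, (0 < p)%N -> 0 <= r p)
  (r_le : forall p, (0 < p)%N -> r p <= C)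
  (r_part : forall p, (0 < p)%N -> r p = r (p`_(\pi(Q)))%N).

Let S N := \sum_(p < N) r p.+1.

Let C_ge0 : 0 <= C.
Proof. exact: le_trans (r_ge0 (ltn0Sn 0)) (r_le _). Qed.

Let S_addn N K : S (N + K) = S N + \sum_(p < K) r (N + p).+1.
Proof. by rewrite /S big_split_ord. Qed.

Let sum_block e j : `|\sum_(p < Q ^ e) r (j * Q ^ e + p).+1 - S (Q ^ e)| <=
  C * (Q * Q ^ e)%:R / 2 ^+ e.
Proof.
rewrite /S -sumrB; apply: le_trans (ler_norm_sum _ _ _) _.
apply: (@le_trans _ _ (\sum_(p < Q ^ e) C * (divisible_by_high_power Q e p.+1)%:R)).
  apply: ler_sum => p _; have [h|h] := boolP (divisible_by_high_power _ _ _).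
    rewrite mulr1; have := r_ge0 (ltn0Sn p); have := r_le (ltn0Sn p).
    have := r_ge0 (ltn0Sn (j * Q ^ e + p)); have := r_le (ltn0Sn (j * Q ^ e + p)).
    by move=> *; rewrite ler_norml; lra.
  rewrite r_part// -addnS partn_add_mul// -r_part//.
  by rewrite subrr normr0 mulr0.
rewrite -mulr_sumr -mulrA ler_wpM2l// ler_pdivlMr ?exprn_gt0//.
by rewrite -natr_sum -natrX -natrM ler_nat sum_high_power_leq.
Qed.

Let sum_blocks e a : `|S (a * Q ^ e) - a%:R * S (Q ^ e)| <=
  a%:R * (C * (Q * Q ^ e)%:R / 2 ^+ e).
Proof.
elim: a => [|a IH]; first by rewrite mul0n /S big_ord0 !mul0r subr0 normr0.
rewrite mulSn addnC S_addn -addn1 natrD !mulrDl !mul1r.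
rewrite opprD addrACA; apply: le_trans (ler_normD _ _) _.
by apply: lerD => //; exact: sum_block.
Qed.

Let mean_near e N : (0 < N)%N ->
  `|S N / N%:R - S (Q ^ e) / (Q ^ e)%:R| <=
  C * Q%:R / 2 ^+ e + 2 * C * (Q ^ e)%:R / N%:R.
Proof.
move=> N0; set t := (Q ^ e)%N; have t0 : (0 < t)%N by rewrite expn_gt0 Q_gt0.
have SN0 K : 0 <= S K by apply: sumr_ge0 => p _; exact: r_ge0.
have SNC K : S K <= C * K%:R.
  rewrite /S mulr_natr -[X in _ *+ X]card_ord -sumr_const.
  by apply: ler_sum => p _; exact: r_le.
set a := (N %/ t)%N; set b := (N %% t)%N.
have Nab : N = (a * t + b)%N by exact: divn_eq.
have bt : (b < t)%N by rewrite ltn_mod.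
have [h0 h1] : 0 <= S N - S (a * t)%N /\ S N - S (a * t)%N <= C * t%:R.
  rewrite Nab S_addn addrC addKr; split; first by apply: sumr_ge0 => p _; exact: r_ge0.
  apply: (@le_trans _ _ (C * b%:R)); last by rewrite ler_wpM2l// ler_nat ltnW.
  rewrite mulr_natr -[X in _ *+ X]card_ord -sumr_const.
  by apply: ler_sum => p _; exact: r_le.
have tR : (0 < t%:R :> R) by rewrite ltr0n.
have NR : (0 < N%:R :> R) by rewrite ltr0n.
have NE : N%:R = a%:R * t%:R + b%:R :> R by rewrite Nab natrD natrM.
have bR : 0 <= (b%:R : R) <= t%:R.
  by apply/andP; split; rewrite ?ler0n// ler_nat ltnW.
have e0 : 0 < 2 ^+ e :> R by rewrite exprn_gt0.
have blocks := sum_blocks e a; rewrite -/t natrM in blocks.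
have St := SNC t; have St0 := SN0 t.
have -> : S N / N%:R - S t / t%:R =
   (S N - S (a * t)%N + (S (a * t)%N - a%:R * S t) - b%:R * (S t / t%:R)) / N%:R.
  by rewrite NE; field; rewrite -NE !gt_eqF.
rewrite normrM (ger0_norm (x := _^-1)) ?invr_ge0 ?ler0n//.
rewrite (ler_pdivrMr _ _ NR).
have hb : 0 <= (b%:R : R) * (S t / t%:R) <= C * t%:R.
  have h : 0 <= S t / (t%:R : R) <= C.
    by apply/andP; split; [rewrite divr_ge0|rewrite ler_pdivrMr].

  by case/andP: bR => b0 bt'; case/andP: h => h h'; apply/andP; split; nra.
have ha : a%:R * (C * (Q%:R * t%:R) / 2 ^+ e) <= C * Q%:R / 2 ^+ e * N%:R.
  rewrite [leLHS](_ : _ = C * Q%:R / 2 ^+ e * (a%:R * t%:R)); last by ring.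
  rewrite ler_wpM2l ?divr_ge0 ?mulr_ge0 ?ler0n ?exprn_ge0// NE lerDl.
  by case/andP: bR.
rewrite mulrDl divfK ?gt_eqF//.
move: blocks hb; rewrite !ler_norml => /andP[b1 b2] /andP[b3 b4].
by apply/andP; split; lra.
Qed.

(** Compare with the average over one period [Q ^ e]: translating by a multiple
    of the period changes [r] only at the few places divisible by a high power.
    The averages are therefore Cauchy. *)
Theorem cvg_mean_of_part : cvg ((S N / N%:R) @[N --> \oo]).
Proof.
apply: cauchy_cvg; apply: cauchy_exP => eps eps0.
have [e eC] : exists e, C * Q%:R / 2 ^+ e < eps / 2.
  near \oo => e; exists e; rewrite -exprVn; near: e.
  apply: (@cvgr_lt R _ \oo _ _ 0); last by rewrite divr_gt0.
  by apply: cvg_geometric; rewrite ger0_norm ?invr_ge0// invf_lt1// ltr1n.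
exists (S (Q ^ e) / (Q ^ e)%:R).
suff : \forall N \near \oo, ball (S (Q ^ e) / (Q ^ e)%:R) eps (S N / N%:R) by [].
near=> N.
have N0 : (0 < N)%N by near: N; exact: nbhs_infty_gt.
rewrite /ball/= distrC; apply: le_lt_trans (mean_near e N0) _.
rewrite [eps]splitr ltrD// ltr_pdivrMr ?ltr0n//.
rewrite [ltRHS]mulrC -ltr_pdivrMr ?divr_gt0//.
by near: N; exact: nbhs_infty_gtr.
Unshelve. all: by end_near.
Qed.

End MeanValue.

(** * Exponential growth rate of the number of words *)

Section GrowthRate.
Context {R : realType} {m r : nat} (n : 'I_r -> nat).
Hypotheses (n_pos : forall i, (0 < n i)%N) (r_gt0 : (0 < r)%N).
Local Notation A N := (#|words (R := R) (m := m) n N|).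

Lemma card_words0 : A 0 = 1%N.
Proof.
apply/eqP; rewrite eqn_leq card_words_gt0// andbT.
by apply: leq_trans (max_card _) _; rewrite card_ffun !card_ord.
Qed.

(** Telescoping turns [ln (A N) / N] into an average of logarithmic increments,
    to which the mean value theorem for functions of the smooth part applies. *)
Lemma cvg_ln_card_words : cvg ((ln (A N)%:R / N%:R : R) @[N --> \oo]).
Proof.
pose rate p : R := ln (A p)%:R - ln (A p.-1)%:R.
have A0 N : 0 < (A N)%:R :> R by rewrite ltr0n card_words_gt0.
have lnA N : ln (A N)%:R = \sum_(p < N) rate p.+1.
  rewrite -(big_mkord xpredT (fun p => rate p.+1)) telescope_sumr//.
  by rewrite card_words0 ln1 subr0.
under eq_fun do rewrite lnA.
apply: (@cvg_mean_of_part _ _ (ln m.+1%:R) (\prod_j n j)%N).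
- by rewrite prod_n_gt0.
- by case=> // p _; rewrite subr_ge0 ler_ln ?posrE// ler_nat leq_card_words.
- case=> // p _; rewrite lerBlDl -lnM ?posrE// ler_ln ?posrE ?mulr_gt0//.
  by rewrite -natrM ler_nat card_wordsS_leq.
move=> p p0; set pi := \pi(_).
have q0 : (0 < p`_pi)%N by exact: part_gt0.
have i0 : (0 < p`_pi^')%N by exact: part_gt0.
have iQ : (coprime p`_pi^' (\prod_j n j))%N.
  rewrite coprime_sym (@pnat_coprime pi)// ?part_pnat//.
  by rewrite pnat_pi// prod_n_gt0.
have := card_words_exchange (R := R) (m := m) n_pos i0 iQ q0 (part_pnat _ _).
have -> : (p`_pi^' * p`_pi = p)%N by rewrite mulnC partnC.
move=> E.
have /eqP := congr1 (fun k => ln (k%:R : R)) E.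
rewrite !natrM !lnM ?posrE// => /eqP; rewrite /rate => H.
lra.
Qed.

End GrowthRate.

(** * Cylinders and the Minkowski dimension *)

Section Cylinders.
Context {R : realType} {m : nat}.
Local Notation T := (Sigma R m.+1).
Implicit Types (x y : T) (U : set T) (N : nat).

Definition agree N x y := forall p, (0 < p <= N)%N -> entry x p = entry y p.

Lemma mdist_le_of_agree N x y : agree N x y -> mdist x y <= m.+1%:R ^- N.+1.
Proof.
move=> xy; rewrite -[mdist x y]/(Sigma_dist x y) /Sigma_dist.
case: pselect => [_|nxy]; first by rewrite invr_ge0 exprn_ge0.
case: ex_minnP => k /andP[k0 xyk] _.
rewrite lef_pV2 ?posrE ?exprn_gt0// ler_weXn2l ?ler1n// ltnNge.
by apply: contra xyk => kN; rewrite xy// k0.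
Qed.

Lemma agree_of_mdist_lt N x y : mdist x y < m.+1%:R ^- N -> agree N x y.
Proof.
move=> xy p /andP[p0 pN]; apply: contraTeq xy => xyp; rewrite -leNgt.
have /Sigma_dist_le : differ_at x y p by rewrite /differ_at p0.
apply: le_trans; rewrite lef_pV2 ?posrE ?exprn_gt0//.
by rewrite ler_weXn2l// ler1n.
Qed.

Definition cylinder N x : set T := [set y | agree N y x].

Lemma diam_cylinder_le N x : (diam (cylinder N x) <= (m.+1%:R ^- N.+1)%:E)%E.
Proof.
apply: ge_ereal_sup => _ [[y z] [/= xy xz] <-]; rewrite lee_fin.
by apply: mdist_le_of_agree => p pN; rewrite xy// xz.
Qed.

Lemma mdist_le_diam U x y : U x -> U y -> ((mdist x y)%:E <= diam U)%E.
Proof. by move=> Ux Uy; apply: ereal_sup_ubound; exists (x, y). Qed.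

Lemma agree_pad_start N x : agree N (pad (start N x)) x.
Proof. by move=> p /andP[p0 pN]; rewrite entry_pad_start// pN. Qed.

Lemma agree_pad_inj N (v w : {ffun 'I_N -> 'I_m.+1}) :
  agree N (pad v : T) (pad w) -> v = w.
Proof.
move=> vw; apply: (can_inj (@padK R m N)); apply: eq_from_entry => p p0.
have [pN|Np] := leqP p N; first by apply: vw; rewrite p0.
by rewrite !zero_after_pad.
Qed.

End Cylinders.

Lemma exists_scale {R : realType} (b eps : R) : 2 <= b -> 0 < eps < 1 ->
  exists N, b ^- N.+1 <= eps < b ^- N.
Proof.
move=> b2 /andP[e0 e1]; have b0 : 0 < b by lra.
have ex : exists k, b ^- k <= eps.
  exists (Num.bound eps^-1).
  rewrite -[leRHS]invrK lef_pV2 ?posrE ?exprn_gt0 ?invr_gt0//.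
  apply/ltW/(lt_le_trans (archi_boundP _)); first by rewrite invr_ge0 ltW.
  apply: (@le_trans _ _ (2 ^+ Num.bound eps^-1)); last by rewrite lerXn2r ?nnegrE//; lra.
  by rewrite -natrX ler_nat ltnW// ltn_expl.
case: (ex_minnP ex) => -[|N] bN Nmin; first by move: bN; rewrite expr0 invr1; lra.
by exists N; rewrite bN ltNge; apply/negP => /Nmin; rewrite ltnn.
Qed.

Section Minkowski.
Context {R : realType} {m r : nat} (n : 'I_r -> nat).
Hypotheses (m_gt0 : (0 < m)%N) (n_pos : forall i, (0 < n i)%N).
Hypothesis r_gt0 : (0 < r)%N.
Local Notation T := (Sigma R m.+1).
Local Notation X := (mult_shift R m.+1 n).
Local Notation W N := (words (R := R) (m := m) n N).

(** A set of diameter less than [m.+1%:R ^- N] meets at most one cylinder of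
    length [N], and every word is the prefix of its zero padding, so no cover does better
    than the cylinders. *)
Lemma covering_number_mult_shift N (eps : R) :
  m.+1%:R ^- N.+1 <= eps < m.+1%:R ^- N ->
  covering_number X eps = (#|W N|%:R)%:E.
Proof.
move=> /andP[epsN Neps]; apply/eqP; rewrite eq_le; apply/andP; split.
  apply: ereal_inf_lbound; exists #|W N| => //.
  exists (fun i => cylinder N (pad (enum_val i))); split => [x Xx|i]; last first.
    by apply: le_trans (diam_cylinder_le _ _) _; rewrite lee_fin.
  have xW : start N x \in W N by apply/wordsP; exact: mult_shift_pad_start.
  exists (enum_rank_in xW (start N x)) => //.
  by rewrite enum_rankK_in// => p pN; rewrite agree_pad_start.
apply: le_ereal_inf_tmp => _ [k [U [XU Ueps]] <-]; rewrite lee_fin ler_nat.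
have /card_gt0P[w0 w0W] := card_words_gt0 (R := R) (m := m) n r_gt0 N.
have /wordsP/XU[i0 _ _] := w0W.
have /choice[h hU] : forall w : {ffun 'I_N -> 'I_m.+1},
    exists i, w \in W N -> U i (pad w).
  move=> w; have [/wordsP/XU[i _ Ui]|wW] := boolP (w \in W N); first by exists i.
  by exists i0.
rewrite -[leqRHS]card_ord -cardsT; apply: (leq_card_map (f := h)) => [v w vW wW vw|//].
apply: (agree_pad_inj (R := R)); apply: agree_of_mdist_lt.
apply: le_lt_trans Neps; rewrite -lee_fin; apply: le_trans (Ueps (h v)).
by apply: mdist_le_diam; [exact: hU|rewrite vw; exact: hU].
Qed.

Lemma minkowski_ratio_mult_shift N (eps : R) :
  m.+1%:R ^- N.+1 <= eps < m.+1%:R ^- N ->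
  minkowski_ratio X eps = (ln #|W N|%:R / ln eps^-1)%:E.
Proof.
move=> eN; rewrite /minkowski_ratio (covering_number_mult_shift eN) lne_EFin//.
by rewrite ltr0n card_words_gt0.
Qed.

(** For [eps] between consecutive powers [N] and [N.+1] of [m.+1%:R^-1], the
    numerator is the logarithm of the number of words of length [N] and the
    denominator lies between [N * ln m.+1] and [N.+1 * ln m.+1]. *)
Lemma cvg_minkowski_ratio (l : R) : ln #|W N|%:R / N%:R @[N --> \oo] --> l ->
  minkowski_ratio X eps @[eps --> 0^'+] --> (l / ln m.+1%:R)%:E.
Proof.
move=> Wl; set c := ln m.+1%:R; have c0 : 0 < c by rewrite ln_gt0// ltr1n.
have near_scale N0 : \forall eps \near (0 : R)^'+, exists N,
    (N0 < N)%N /\ m.+1%:R ^- N.+1 <= eps < m.+1%:R ^- N.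
  near=> eps.
  have [||N eN] := @exists_scale R m.+1%:R eps.
  - by rewrite ler_nat.
  - apply/andP; split; near: eps; first exact: nbhs_right_gt.
    exact: nbhs_right_lt.
  exists N; split=> //; have /andP[Neps _] := eN.
  have : eps < m.+1%:R ^- N0.+1.
    by near: eps; apply: nbhs_right_lt; rewrite invr_gt0 exprn_gt0.
  move=> /(le_lt_trans Neps); rewrite ltf_pV2 ?posrE ?exprn_gt0// ltr_eXn2l ?ltr1n//.
apply/fine_cvgP; split.
  near=> eps.
  have [N [_ eN]] : exists N, (0 < N)%N /\ m.+1%:R ^- N.+1 <= eps < m.+1%:R ^- N.
    by near: eps; exact: near_scale.
  by rewrite (minkowski_ratio_mult_shift eN).
apply/cvgrPdist_le => e e0.
pose d := e * c / 2; have d0 : 0 < d by rewrite !mulr_gt0.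
have /cvgrPdist_le /(_ _ d0) [N1 _ WN1] := Wl.
have A1 N : 1 <= #|W N|%:R :> R by rewrite ler1n card_words_gt0.
have l0 : 0 <= l.
  apply: (cvgr_to_ge Wl); apply: nearW => N.
  by rewrite divr_ge0 ?ler0n//; apply: ln_ge0; exact: A1.
(* Beyond [N2], replacing [N.+1] by [N] costs at most [d]. *)
pose N2 := Num.bound ((l + d) / d).
near=> eps.
have [N [NN eN]] : exists N, (maxn N1 N2 < N)%N /\
    m.+1%:R ^- N.+1 <= eps < m.+1%:R ^- N.
  by near: eps; exact: near_scale.
rewrite /= (minkowski_ratio_mult_shift eN)/=.
move: NN; rewrite gtn_max => /andP[N1N N2N].
have NR : 0 < (N%:R : R) by rewrite ltr0n; case: (N) N1N.
have dN : l + d <= d * N%:R.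
  rewrite [leRHS]mulrC -ler_pdivrMr//; apply/ltW/(lt_le_trans (archi_boundP _)).
    by apply: divr_ge0; [apply: addr_ge0|]; rewrite // ltW.
  by rewrite ler_nat ltnW.
have eps0 : 0 < eps by near: eps; exact: nbhs_right_gt.
have /andP[L1 L2] : N%:R * c <= ln eps^-1 <= (N%:R + 1) * c.
  have m0 : 0 < (m.+1%:R : R) by [].
  rewrite -(natrD _ N 1) addn1 !mulr_natl -!lnXn//.
  rewrite !ler_ln ?posrE ?exprn_gt0 ?invr_gt0//.
  have /andP[e1 e2] := eN; apply/andP; split.
    by rewrite -[leLHS]invrK lef_pV2 ?posrE ?invr_gt0 ?exprn_gt0// ltW.
  by rewrite -[leRHS]invrK lef_pV2 ?posrE ?invr_gt0 ?exprn_gt0.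
have := WN1 N (ltnW N1N); rewrite /= ler_norml.
have a0 : 0 <= ln (#|W N|%:R : R) by apply: ln_ge0; exact: A1.
set a := ln _ in a0 *; set L := ln _ in L1 L2 * => /andP[q1 q2].
have qa : a = a / N%:R * N%:R by rewrite divfK ?gt_eqF.
set q := a / N%:R in q1 q2 qa.
have L0 : 0 < L by apply: lt_le_trans L1; exact: mulr_gt0.
have ed : e = 2 * d / c by rewrite /d; field; rewrite gt_eqF.
rewrite ler_norml; apply/andP; split.
  rewrite lerBrDr addrC lerBlDr ler_pdivrMr//.
  apply: (@le_trans _ _ ((l / c + e) * (N%:R * c))); last first.
    apply: ler_wpM2l => //; apply: addr_ge0; last exact: ltW.
    by apply: divr_ge0 => //; exact: ltW.
  rewrite ed [leRHS](_ : _ = (l + 2 * d) * N%:R); last by field; rewrite gt_eqF.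
  by rewrite qa; apply: ler_wpM2r; [exact: ltW|lra].
rewrite lerBlDr -lerBlDl ler_pdivlMr//.
have [lce|lce] := leP (l / c - e) 0.
  by apply: le_trans a0; rewrite mulr_le0_ge0// ltW.
apply: (@le_trans _ _ ((l / c - e) * ((N%:R + 1) * c))).
  by rewrite ler_wpM2l// ltW.
rewrite ed [leLHS](_ : _ = (l - 2 * d) * (N%:R + 1)); last by field; rewrite gt_eqF.
rewrite qa; have : (l - d) * N%:R <= q * N%:R by apply: ler_wpM2r; [exact: ltW|lra].
lra.
Unshelve. all: by end_near.
Qed.

End Minkowski.

(** * Resampling disjoint blocks of a word *)

Section Blocks.
Context {R : realType} {m r : nat} (n : 'I_r -> nat).
Hypothesis n_pos : forall i, (0 < n i)%N.
Hypothesis n_inj : injective n.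
Variable jmax : 'I_r.
Variable t : nat.
Local Notation T := (Sigma R m.+1).
Local Notation X := (mult_shift R m.+1 n).
Local Notation Q := (\prod_j n j)%N.
Local Notation M := (n jmax).
Local Notation block := {ffun 'I_r -> 'I_m.+1}.
Implicit Types (x : T) (b : {ffun 'I_t -> block}) (u v : 'I_t).

(** The length scale of the window.  It is a multiple of [Q * M.+1] so that the
    window [Q * M * t < i <= horizon] has length exactly [Q * t]. *)
Definition horizon := (Q * M.+1 * t)%N.

(** The [t] integers congruent to 1 modulo [Q] in the window: they are coprime
    to [Q], which makes their blocks disjoint. *)
Definition pivot (u : 'I_t) := (Q * (M * t + u)).+1.

Lemma pivot_gt u : (Q * M * t < pivot u)%N.
Proof. by rewrite /pivot ltnS -mulnA leq_mul2l leq_addr orbT. Qed.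

Lemma pivot_le u : (pivot u <= horizon)%N.
Proof.
have Q0 := prod_n_gt0 n_pos; have := ltn_ord u.
rewrite /pivot /horizon => ut; rewrite -mulnA ltn_mul2l Q0/= mulSn addnC.
by rewrite ltn_add2r.
Qed.

Lemma pivot_coprime u j : coprime (pivot u) (n j).
Proof.
have : coprime (pivot u) Q.
  by apply: (@coprime_dvdr _ (Q * (M * t + u))); rewrite ?coprimeSn ?dvdn_mulr.
by apply: coprime_dvdr; exact: dvdn_prod_n.
Qed.

Lemma horizon_lt_pivot2 u : (horizon < (pivot u).*2)%N.
Proof.
apply: (@leq_ltn_trans (Q * M * t).*2); last by rewrite ltn_double pivot_gt.
rewrite -muln2 /horizon -!mulnA leq_mul2l; apply/orP; right.
by rewrite mulSn mulnA muln2 -addnn leq_add2r leq_pmull.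
Qed.

Lemma dvdn_pivot u k j l : (k * n l = pivot u * n j)%N -> (pivot u %| k)%N.
Proof.
move=> kl; rewrite -(@Gauss_dvdl _ _ (n l)) ?pivot_coprime//.
by rewrite kl dvdn_mulr.
Qed.

(** A constraint [k] touching the block of a pivot is a multiple of the pivot,
    hence equal to it, since the window lies above half the horizon. *)
Lemma eq_pivot u k j l : (0 < k)%N -> (k <= horizon)%N ->
  (k * n l = pivot u * n j)%N -> k = pivot u.
Proof.
move=> k0 kh /dvdn_pivot/dvdnP[[|[|s]] ks]; first by rewrite ks in k0.
  by rewrite ks mul1n.
have := leq_ltn_trans kh (horizon_lt_pivot2 u).
by rewrite ks -muln2 mulnC ltn_mul2l.
Qed.

Lemma pivot_inj : injective pivot.
Proof.
move=> u v /eqP; rewrite eqSS eqn_mul2l gtn_eqF ?prod_n_gt0//= eqn_add2l.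
by move=> /eqP uv; apply: val_inj.
Qed.

Definition block_pos (uj : 'I_t * 'I_r) := (pivot uj.1 * n uj.2)%N.

Lemma block_pos_gt0 uj : (0 < block_pos uj)%N.
Proof. by rewrite muln_gt0 n_pos. Qed.

Lemma block_pos_inj : injective block_pos.
Proof.
move=> [u j] [v l]; rewrite /block_pos/= => E.
have /pivot_inj uv := eq_pivot (ltn0Sn _) (pivot_le u) E.
by move: E => /eqP; rewrite uv eqn_mul2l/= => /eqP/n_inj ->.
Qed.

Definition set_blocks x b : T := of_entries (fun p =>
  if [pick uj | block_pos uj == p] is Some uj then b uj.1 uj.2 else entry x p).

Definition get_blocks x : {ffun 'I_t -> block} :=
  [ffun u => [ffun j => entry x (pivot u * n j)%N]].

Lemma entry_set_blocks x b u j : entry (set_blocks x b) (pivot u * n j) = b u j.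
Proof.
rewrite entry_of_entries ?(block_pos_gt0 (u, j))//; case: pickP => [uj /eqP|].
  by move=> /(block_pos_inj (x2 := (u, j))) ->.
by move=> /(_ (u, j)); rewrite eqxx.
Qed.

Lemma entry_set_blocks_out x b p : (0 < p)%N ->
  (forall u j, pivot u * n j != p)%N -> entry (set_blocks x b) p = entry x p.
Proof.
move=> p0 np; rewrite entry_of_entries//; case: pickP => // -[u j] /eqP up.
by have := np u j; rewrite -up eqxx.
Qed.

Lemma get_set_blocks x b : get_blocks (set_blocks x b) = b.
Proof. by apply/ffunP => u; apply/ffunP => j; rewrite !ffunE entry_set_blocks. Qed.

Lemma set_set_blocks x b : set_blocks (set_blocks x b) (get_blocks x) = x.
Proof.
apply: eq_from_entry => p p0.
have [[[u j] <-]|np] := pselect (exists uj, block_pos uj = p).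
  by rewrite entry_set_blocks !ffunE.
have np' u j : (pivot u * n j != p)%N by apply/eqP => E; apply: np; exists (u, j).
by rewrite !entry_set_blocks_out.
Qed.

Lemma set_blocks_zero_after N x b : zero_after N x ->
  (forall u j, (N < pivot u * n j)%N -> b u j = ord0) ->
  zero_after N (set_blocks x b).
Proof.
move=> x0 b0 p Np; have p0 : (0 < p)%N by exact: leq_ltn_trans Np.
have [[[u j] up]|np] := pselect (exists uj, block_pos uj = p).
  by rewrite -up entry_set_blocks b0// -[leqRHS]/(block_pos (u, j)) up.
rewrite entry_set_blocks_out ?x0// => u j.
by apply/eqP => E; apply: np; exists (u, j).
Qed.

(** Blocks can be refilled at will, subject to their own constraint: any other
    constraint has its last place beyond the word or misses the blocks. *)
Lemma set_blocks_mult_shift N x b : (N <= M * horizon)%N ->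
  zero_after N (set_blocks x b) -> (forall u, exists j, b u j = ord0) ->
  X x -> X (set_blocks x b).
Proof.
move=> NM b0 bz /mult_shiftP Xx; apply/mult_shiftP => k k0.
have [[u ->]|nk] := pselect (exists u, k = pivot u).
  by have [j bj] := bz u; exists j; rewrite entry_set_blocks.
have [Nk|kN] := ltnP N (k * M); first by exists jmax; exact: b0.
have [j xj] := Xx _ k0; exists j.
rewrite entry_set_blocks_out ?muln_gt0 ?k0 ?n_pos// => u l; apply/eqP => E.
apply: nk; exists u; apply: (eq_pivot (j := l) (l := j)) => //.
by move: (leq_trans kN NM); rewrite mulnC leq_mul2l gtn_eqF//= n_pos.
Qed.

Variables (N : nat) (B : {set block}).
Hypotheses (N_le : (N <= M * horizon)%N)
  (B_zero : forall c, c \in B -> exists j, c j = ord0)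
  (B_trunc : forall c u j, c \in B -> (N < pivot u * n j)%N -> c j = ord0)
  (B_get : forall x u, X x -> zero_after N x -> get_blocks x u \in B).

Local Notation W := (words (R := R) (m := m) n N).

(** In a uniformly random word the blocks of the pivots are independent and
    uniform in [B]: exchanging the contents of the blocks of a word with a
    family of [t] elements of [B] is an involution on pairs. *)
Lemma sum_prod_blocks (f : block -> R) :
  (\sum_(w in W) \prod_u f (get_blocks (pad w : T) u)) * (#|B| ^ t)%:R =
  #|W|%:R * (\sum_(c in B) f c) ^+ t.
Proof.
pose P (wb : {ffun 'I_N -> 'I_m.+1} * {ffun 'I_t -> block}) :=
  (wb.1 \in W) && (wb.2 \in ffun_on B).
pose swap (wb : {ffun 'I_N -> 'I_m.+1} * {ffun 'I_t -> block}) :=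
  (start N (set_blocks (pad wb.1) wb.2), get_blocks (pad wb.1 : T)).
have set0 wb : P wb -> zero_after N (set_blocks (pad wb.1) wb.2).
  case: wb => w b /andP[/= _ /ffun_onP bB].
  apply: set_blocks_zero_after => [|u j]; first exact: zero_after_pad.
  exact: B_trunc (bB u).
have swapP wb : P wb -> P (swap wb).
  move=> Pwb; have := set0 _ Pwb; move: Pwb; case: wb => w b.
  move=> /andP[/= /wordsP Xw /ffun_onP bB] z; apply/andP; split => /=.
    apply: start_words => //; apply: set_blocks_mult_shift z _ Xw => // u.
    exact: B_zero (bB u).
  by apply/ffun_onP => u; apply: B_get => //; exact: zero_after_pad.
have swapK wb : P wb -> swap (swap wb) = wb.
  move=> /set0; case: wb => w b /= z.
  by rewrite /swap/= startK// set_set_blocks padK get_set_blocks.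
transitivity (\sum_(wb | P wb) \prod_u f (get_blocks (pad wb.1 : T) u)).
  rewrite -(pair_big (mem W) (fun b => b \in ffun_on B)
    (fun w _ => \prod_u f (get_blocks (pad w : T) u)))/=.
  rewrite mulr_suml; apply: eq_bigr => w _.
  by rewrite sumr_const card_ffun_on card_ord mulr_natr.
rewrite (reindex_onto swap swap)//=.
transitivity (\sum_(wb | P wb) \prod_u f (wb.2 u)).
  apply: eq_big => wb; last first.
    by move=> /andP[_ /eqP E]; apply: eq_bigr => u _; rewrite -[in RHS]E.
  apply/andP/idP => [[/swapP Pw /eqP <-]//|Pw]; split; first exact: swapP.
  by rewrite swapK.
rewrite -(pair_big (mem W) (fun b => b \in ffun_on B)
    (fun _ b => \prod_u f (b u)))/=.
rewrite sumr_const mulr_natl; congr (_ *+ _).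
by rewrite -(bigA_distr_big (mem B) (fun _ => f)) prodr_const card_ord.
Qed.

End Blocks.

(** * Two lengths with incompatible statistics *)

(** The witnesses are the square roots of the likelihood ratios of two coin
    flips; both means are then the Bhattacharyya coefficient, which is less than
    one because the coins differ. *)
Lemma bhattacharyya_lt1 {R : realType} (p q : R) :
  0 < p < 1 -> 0 < q < 1 -> p != q ->
  exists a b l : R, [/\ 0 < a, 0 < b, 0 < l < 1,
    p * a + (1 - p) * b = l & q / a + (1 - q) / b = l].
Proof.
move=> /andP[p0 p1] /andP[q0 q1] pq.
have := sqr_sqrtr (ltW p0); have := sqr_sqrtr (ltW q0).
have p1' : 0 < 1 - p by rewrite subr_gt0.
have q1' : 0 < 1 - q by rewrite subr_gt0.
have := sqr_sqrtr (ltW p1'); have := sqr_sqrtr (ltW q1').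
have x0 : 0 < Num.sqrt p by rewrite sqrtr_gt0.
have y0 : 0 < Num.sqrt q by rewrite sqrtr_gt0.
have u0 : 0 < Num.sqrt (1 - p) by rewrite sqrtr_gt0.
have v0 : 0 < Num.sqrt (1 - q) by rewrite sqrtr_gt0.
have xy : Num.sqrt p != Num.sqrt q by rewrite eqr_sqrt ?ltW.
move: x0 y0 u0 v0 xy; set x := Num.sqrt p; set y := Num.sqrt q.
set u := Num.sqrt (1 - p); set v := Num.sqrt (1 - q) => x0 y0 u0 v0 xy ev eu ey ex.
exists (y / x), (v / u), (x * y + u * v); split.
- exact: divr_gt0.
- exact: divr_gt0.
- rewrite addr_gt0 ?mulr_gt0//=.
  have h1 : 0 < (x - y) ^+ 2 by rewrite exprn_even_gt0//= subr_eq0.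
  have h2 : 0 <= (u - v) ^+ 2 by rewrite sqr_ge0.
  nra.
- by rewrite -eu -ex; field; rewrite !gt_eqF.
- by rewrite -ev -ey; field; rewrite !gt_eqF.
Qed.

Section TwoScales.
Context {R : realType} {m r : nat} (n : 'I_r -> nat).
Hypotheses (m_gt0 : (0 < m)%N) (r_gt1 : (1 < r)%N).
Hypothesis n_pos : forall i, (0 < n i)%N.
Hypothesis n_inj : injective n.
Variable jmax : 'I_r.
Hypothesis n_le : forall j, (n j <= n jmax)%N.
Local Notation T := (Sigma R m.+1).
Local Notation X := (mult_shift R m.+1 n).
Local Notation M := (n jmax).
Local Notation block := {ffun 'I_r -> 'I_m.+1}.
Local Notation W N := (words (R := R) (m := m) n N).
Implicit Types (c : block) (x : T).

(** Contents of the block of a pivot at the shorter length, where the last place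
    lies beyond the word and is padded by zero; [admissible_blocks] is for the
    longer length. *)
Definition free_blocks : {set block} := [set c : block | c jmax == ord0].
Definition admissible_blocks : {set block} :=
  [set c : block | [exists j, c j == ord0]].
(** The constraint of such a block can only be met by a zero at its last
    place. *)
Definition forcing c := [forall j, (j != jmax) ==> (c j != ord0)].

Lemma exists_neq_jmax : exists j : 'I_r, j != jmax.
Proof.
have [j0|j0] := eqVneq (val jmax) 0%N.
  by exists (Ordinal r_gt1); rewrite -val_eqE/= j0.
by exists (Ordinal (ltnW r_gt1)); rewrite -val_eqE/= eq_sym.
Qed.

Lemma lt_n_max j : j != jmax -> (n j < M)%N.
Proof.
move=> jj; rewrite ltn_neqAle n_le andbT.
by apply: contra jj => /eqP/n_inj ->.
Qed.

(** The forcing blocks are the same at both lengths, whereas the number of all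
    blocks differs: this is why forcing has different probabilities. *)
Lemma forcing_free : free_blocks :&: [set c | forcing c] =
  admissible_blocks :&: [set c | forcing c].
Proof.
apply/setP => c; rewrite !inE; apply: andb_id2r => /forallP fc.
apply/idP/existsP => [cj|[j cj]]; first by exists jmax.
by have [<-//|jj] := eqVneq j jmax; have := fc j; rewrite jj cj.
Qed.

Lemma card_forcing_gt0 : (0 < #|free_blocks :&: [set c | forcing c]|)%N.
Proof.
apply/card_gt0P; exists [ffun j => if j == jmax then ord0 else ord_max].
rewrite !inE ffunE eqxx; apply/forallP => j; apply/implyP => jj.
by rewrite ffunE (negbTE jj) -val_eqE/= -lt0n.
Qed.

Lemma card_forcing_lt : (#|free_blocks :&: [set c | forcing c]| < #|free_blocks|)%N.
Proof.
apply: proper_card; rewrite properE subsetIl/=.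
apply/subsetPn; exists [ffun => ord0]; first by rewrite inE ffunE.
have [j jj] := exists_neq_jmax; rewrite !inE ffunE eqxx/=.
by apply/forallPn; exists j; rewrite jj ffunE eqxx.
Qed.

Lemma card_free_lt : (#|free_blocks| < #|admissible_blocks|)%N.
Proof.
apply: proper_card; apply/properP; split.
  by apply/fintype.subsetP => c; rewrite !inE => cj; apply/existsP; exists jmax.
have [j jj] := exists_neq_jmax.
exists [ffun j => if j == jmax then ord_max else ord0].
  by rewrite inE; apply/existsP; exists j; rewrite ffunE (negbTE jj).
by rewrite inE ffunE eqxx -val_eqE/= -lt0n.
Qed.

Definition weight (a b : R) c := if forcing c then a else b.

Lemma sum_weight a b (B : {set block}) : \sum_(c in B) weight a b c =
  #|B :&: [set c | forcing c]|%:R * a +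
  (#|B|%:R - #|B :&: [set c | forcing c]|%:R) * b.
Proof.
rewrite (bigID forcing)/=; congr (_ + _).
  rewrite mulr_natl -sumr_const; apply: eq_big => [c|c /andP[_ fc]].
    by rewrite !inE.
  by rewrite /weight fc.
rewrite -natrB ?subset_leq_card ?subsetIl// -cardsDS ?subsetIl//.
rewrite mulr_natl -sumr_const; apply: eq_big => [c|c /andP[_ /negbTE fc]].
  by rewrite !inE negb_and andb_orl andNb orFb andbC.
by rewrite /weight fc.
Qed.

Lemma exists_weight : exists a b l : R, [/\ 0 < a, 0 < b, 0 < l < 1,
  \sum_(c in free_blocks) weight a b c = l * #|free_blocks|%:R &
  \sum_(c in admissible_blocks) weight a^-1 b^-1 c = l * #|admissible_blocks|%:R].
Proof.
have := card_forcing_gt0; have := card_forcing_lt; have := card_free_lt.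
rewrite -!(ltr_nat R).
have -> : 0%:R = 0 :> R by [].
set A : R := #|_ :&: _|%:R; set F : R := #|_|%:R; set K : R := #|_|%:R.
move=> FK AF A0; have F0 : 0 < F by lra.
have K0 : 0 < K by lra.
have [||| a [b [l [a0 b0 l01 e1 e2]]]] := @bhattacharyya_lt1 R (A / F) (A / K).
- by rewrite divr_gt0//= ltr_pdivrMr// mul1r.
- by rewrite divr_gt0//= ltr_pdivrMr// mul1r; lra.
- rewrite -subr_eq0 gt_eqF//.
  have -> : A / F - A / K = A * (K - F) / (F * K).
    by field; rewrite !gt_eqF.
  by rewrite divr_gt0 ?mulr_gt0// subr_gt0.
exists a, b, l; split => //; rewrite sum_weight -/A -/F -/K.
  by rewrite -e1; field; rewrite gt_eqF.
by rewrite -forcing_free -/A -e2; field; rewrite !gt_eqF.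
Qed.

Section Fixed_t.
Variable t : nat.
Local Notation H := (horizon n jmax t).

(** Markov's inequality for the product of the weights of the blocks. *)
Lemma card_heavy_words (N : nat) (B : {set block}) (f : block -> R) (l : R) :
  (N <= M * H)%N ->
  (forall c, c \in B -> exists j, c j = ord0) ->
  (forall c (u : 'I_t) j, c \in B -> (N < pivot n jmax u * n j)%N -> c j = ord0) ->
  (forall x u, X x -> zero_after N x -> get_blocks n jmax t x u \in B) ->
  (forall c, 0 <= f c) -> (0 < #|B|)%N -> \sum_(c in B) f c = l * #|B|%:R ->
  #|[set w in W N | 1 <= \prod_u f (get_blocks n jmax t (pad w : T) u)]|%:R <=
  l ^+ t * #|W N|%:R.
Proof.
move=> NM Bz Bt Bg f0 B0 fl.
have := sum_prod_blocks n_pos n_inj NM Bz Bt Bg f.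
rewrite fl exprMn natrX mulrA => /mulIf; rewrite expf_neq0 ?pnatr_eq0 -?lt0n//.
move=> /(_ isT); rewrite mulrC => <-.
rewrite -sum1_card natr_sum big_mkcond [leRHS]big_mkcond/=.
apply: ler_sum => w _; rewrite inE.
case: (w \in W N) => //=; case: ifPn => // _; exact: prodr_ge0.
Qed.

(** The weight ignores the last place of a block, and the other places lie below
    the shorter length. *)
Lemma weight_get_blocks a b N x u : (M.-1 * H <= N)%N ->
  weight a b (get_blocks n jmax t (pad (start N x) : T) u) =
  weight a b (get_blocks n jmax t x u).
Proof.
move=> HN; rewrite /weight; congr (if _ then _ else _).
apply: eq_forallb => j; have [//|jj/=] := eqVneq j jmax.
rewrite !ffunE entry_pad_start ?muln_gt0 ?n_pos// ifT//.
apply: leq_trans HN; rewrite mulnC leq_mul// ?pivot_le//.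
by rewrite -ltnS prednK// lt_n_max.
Qed.

End Fixed_t.

(** The statistics of the two lengths are incompatible.  Weighting each block of
    the window by [a] or [b] multiplies the mean by [l] per block at the shorter
    length, and so do the inverse weights at the longer length.  The total
    weight of a word depends only on its entries below both lengths, and of a
    positive number and its inverse one is at least [1]: every point has a heavy
    prefix for one of the two weightings, and heavy prefixes are rare. *)
Theorem exists_thin_words : exists l : R, 0 < l < 1 /\ forall t,
  exists (G0 : {set {ffun 'I_(M.-1 * horizon n jmax t) -> 'I_m.+1}})
    (G1 : {set {ffun 'I_(M * horizon n jmax t) -> 'I_m.+1}}),
  [/\ #|G0|%:R <= l ^+ t * #|W (M.-1 * horizon n jmax t)|%:R,
     #|G1|%:R <= l ^+ t * #|W (M * horizon n jmax t)|%:R &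
     forall x, X x -> start _ x \in G0 \/ start _ x \in G1].
Proof.
have [a [b [l [a0 b0 l01 ea eb]]]] := exists_weight.
have wt_gt0 a' b' c : 0 < a' -> 0 < b' -> 0 < weight a' b' c.
  by rewrite /weight; case: ifP.
exists l; split => // t.
eexists; eexists; split.
- apply: (card_heavy_words (t := t) (N := (M.-1 * horizon n jmax t)%N)
    (B := free_blocks) (f := weight a b)) => //.
  + by rewrite leq_mul2r leq_pred orbT.
  + by move=> c; rewrite inE => /eqP; exists jmax.
  + move=> c u j; rewrite inE => /eqP cj.
    have [->//|jj] := eqVneq j jmax.
    rewrite ltnNge mulnC leq_mul// ?pivot_le//.
    by rewrite -ltnS prednK// lt_n_max.
  + move=> x u Xx x0; rewrite inE !ffunE; apply/eqP/x0.
    have := pivot_gt n jmax u; rewrite /horizon; have := n_pos jmax.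
    case: (n jmax) => // k _ /=; nia.
  + by move=> c; rewrite ltW// wt_gt0.
  + exact: leq_ltn_trans card_forcing_lt.
- apply: (card_heavy_words (t := t) (N := (M * horizon n jmax t)%N)
    (B := admissible_blocks) (f := weight a^-1 b^-1)) => //.
  + by move=> c; rewrite inE => /existsP[j /eqP]; exists j.
  + by move=> c u j _; rewrite ltnNge mulnC leq_mul// pivot_le.
  + move=> x u /mult_shiftP Xx _; have [//|j xj] := Xx (pivot n jmax u).
    by rewrite inE; apply/existsP; exists j; rewrite !ffunE xj.
  + by move=> c; rewrite ltW// wt_gt0 ?invr_gt0.
  + exact: leq_ltn_trans card_free_lt.
move=> x Xx; rewrite [in X in X \/ _]inE [in X in _ \/ X]inE.
have Ws N : start N x \in W N by apply/wordsP; exact: mult_shift_pad_start.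
rewrite !Ws/=.
under eq_bigr do rewrite weight_get_blocks//.
under [X in _ \/ (is_true (1 <= X))]eq_bigr do
  rewrite weight_get_blocks ?leq_mul2r ?leq_pred ?orbT//.
set g := \prod_u _; have g0 : 0 < g by apply: prodr_gt0 => u _; exact: wt_gt0.
have -> : \prod_u weight a^-1 b^-1 (get_blocks n jmax t x u) = g^-1.
  by rewrite -prodfV; apply: eq_bigr => u _; rewrite /weight; case: ifP.
have [g1|/ltW g1] := leP 1 g; [by left|right].
by rewrite invf_ge1.
Qed.

End TwoScales.

(** * Efficient covers and the Hausdorff dimension *)

Section HausdorffDim.
Context {R : realType} {T : metricType R}.
Implicit Types (A U : set T) (s delta : R).

Lemma diam_pow_ge0 s U : (0 <= diam_pow s U)%E.
Proof. by rewrite /diam_pow; case: ifP => // _; exact: poweR_ge0. Qed.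

Lemma hausdorff_content_ge0 s delta A : (0 <= hausdorff_content s delta A)%E.
Proof.
apply: le_ereal_inf_tmp => _ [U _ <-].
by apply: nneseries_ge0 => i _ _; exact: diam_pow_ge0.
Qed.

(** A finite cover is completed by empty sets, which cost nothing. *)
Lemma hausdorff_content_le_seq s delta A (l : seq (set T)) :
  (forall x, A x -> exists2 U, U \in l & U x) ->
  (forall U, U \in l -> (diam U <= delta%:E)%E) ->
  (hausdorff_content s delta A <= \sum_(U <- l) diam_pow s U)%E.
Proof.
move=> Al ld; apply: ereal_inf_lbound; exists (nth set0 l).
  split=> [x /Al[U Ul Ux]|i].
    by exists (index U l) => //; rewrite nth_index.
  have [il|li] := ltnP i (size l); first by rewrite ld// mem_nth.
  rewrite nth_default//; apply: ge_ereal_sup => _ [[y z] [/= []]].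
rewrite (nneseries_split 0 (size l)); last by move=> k _; exact: diam_pow_ge0.
rewrite add0n eseries0 ?adde0; last first.
  by move=> i li _; rewrite nth_default// /diam_pow eqxx.
by rewrite (big_nth set0).
Qed.

Lemma hausdorff_dim_le s A : 0 <= s ->
  (forall delta e, 0 < delta -> 0 < e -> (hausdorff_content s delta A <= e%:E)%E) ->
  (hausdorff_dim A <= s%:E)%E.
Proof.
move=> s0 h; apply: ereal_inf_lbound; exists s => //; split => //.
apply/eqP; rewrite eq_le; apply/andP; split.
  apply: ge_ereal_sup => _ [delta /= d0 <-].
  by apply/lee_addgt0Pr => e e0; rewrite add0e; exact: h.
apply: le_trans (hausdorff_content_ge0 s 1 A) _.
by apply: ereal_sup_ubound; exists 1 => /=.
Qed.

End HausdorffDim.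

Lemma diam_pow_cylinder_le {R : realType} {m : nat} (s : R) N (x : Sigma R m.+1) :
  0 <= s -> (diam_pow s (cylinder N x) <= (powR (m.+1%:R ^- N.+1) s)%:E)%E.
Proof.
move=> s0; have cx : cylinder N x x by [].
rewrite /diam_pow ifF; last by apply/negbTE/set0P; exists x.
have d0 : (0 <= diam (cylinder N x))%E.
  by apply: le_trans (mdist_le_diam cx cx); rewrite lee_fin mdist_ge0.
have dN := diam_cylinder_le N x.
rewrite -poweR_EFin; apply: gt0_ler_poweR => //; rewrite in_itv/= leey andbT//.
Qed.

Section CoverSums.
Context {R : realType} {m r : nat} (n : 'I_r -> nat).
Hypotheses (m_gt0 : (0 < m)%N) (r_gt1 : (1 < r)%N).
Hypothesis n_pos : forall i, (0 < n i)%N.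
Hypothesis n_inj : injective n.
Local Notation T := (Sigma R m.+1).
Local Notation X := (mult_shift R m.+1 n).
Local Notation W N := (words (R := R) (m := m) n N).
Local Notation radius N := (m.+1%:R ^- N.+1 : R).

Lemma hausdorff_content_two_scales (s delta : R) N0 N1
    (G0 : {set {ffun 'I_N0 -> 'I_m.+1}}) (G1 : {set {ffun 'I_N1 -> 'I_m.+1}}) :
  0 <= s -> radius N0 <= delta -> radius N1 <= delta ->
  (forall x, X x -> start N0 x \in G0 \/ start N1 x \in G1) ->
  (hausdorff_content s delta X <=
   (#|G0|%:R * powR (radius N0) s + #|G1|%:R * powR (radius N1) s)%:E)%E.
Proof.
move=> s0 d0 d1 XG.
pose cyl N (G : {set {ffun 'I_N -> 'I_m.+1}}) : seq (set T) :=
  [seq cylinder N (pad w : T) | w <- enum G].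
have cyl_diam N (G : {set {ffun 'I_N -> 'I_m.+1}}) U : radius N <= delta ->
    U \in cyl N G -> (diam U <= delta%:E)%E.
  move=> Nd /mapP[w _ ->]; apply: le_trans (diam_cylinder_le _ _) _.
  by rewrite lee_fin.
have cyl_sum N (G : {set {ffun 'I_N -> 'I_m.+1}}) :
    (\sum_(U <- cyl N G) diam_pow s U <= (#|G|%:R * powR (radius N) s)%:E)%E.
  rewrite big_map big_enum/= mulr_natl -sumr_const -sumEFin.
  by apply: lee_sum => w _; exact: diam_pow_cylinder_le.
have cyl_mem N (G : {set {ffun 'I_N -> 'I_m.+1}}) x : start N x \in G ->
    exists2 U, U \in cyl N G & U x.
  move=> xG; exists (cylinder N (pad (start N x))).
    by apply: map_f; rewrite mem_enum.
  by move=> p pN; rewrite agree_pad_start.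
apply: le_trans (hausdorff_content_le_seq (l := cyl _ G0 ++ cyl _ G1) _ _ _) _.
- move=> x /XG[/cyl_mem|/cyl_mem] [U Ul Ux]; exists U => //.
    by rewrite mem_cat Ul.
  by rewrite mem_cat Ul orbT.
- by move=> U; rewrite mem_cat => /orP[]; exact: cyl_diam.
by rewrite big_cat EFinD leeD.
Qed.

(** At length [N] there are about [expR (l * N)] words and cylinders of diameter
    [expR (- N * ln m.+1)].  The factor [la ^+ t] gained by thin covers is
    exponential in the length, so for small [eta] it beats the loss
    [expR (2 * eta * N)] from bounding the growth rate by [l + eta] and lowering
    the exponent to [(l - eta) / ln m.+1]. *)
Lemma exists_thin_covers (l : R) : ln #|W N|%:R / N%:R @[N --> \oo] --> l ->
  exists s : R, 0 <= s < l / ln m.+1%:R /\ forall N e, 0 < e ->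
  exists N0 N1 (G0 : {set {ffun 'I_N0 -> 'I_m.+1}})
    (G1 : {set {ffun 'I_N1 -> 'I_m.+1}}),
  [/\ (N <= N0)%N, (N <= N1)%N,
      forall x, X x -> start N0 x \in G0 \/ start N1 x \in G1 &
      #|G0|%:R * powR (radius N0) s + #|G1|%:R * powR (radius N1) s <= e].
Proof.
move=> Wl; set c := ln m.+1%:R; have c0 : 0 < c by rewrite ln_gt0// ltr1n.
have r0 : (0 < r)%N by exact: ltnW.
have [jmax n_le] : exists jmax, forall j, (n j <= n jmax)%N.
  case: (@arg_maxnP _ (Ordinal r0) xpredT n) => // j _ h; exists j => i; exact: h.
have M1 : (1 < n jmax)%N.
  have [j jj] := exists_neq_jmax r_gt1 jmax.
  exact: leq_ltn_trans (n_pos j) (lt_n_max n_inj n_le jj).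
have [la [/andP[la0 la1] thin]] :=
  exists_thin_words (R := R) m_gt0 r_gt1 n_pos n_inj n_le.
pose K := (n jmax * (\prod_j n j * (n jmax).+1))%N.
have Q0 := prod_n_gt0 n_pos.
have K0 : 0 < (K%:R : R) by rewrite ltr0n !muln_gt0 Q0 n_pos.
have lnla : ln la < 0 by rewrite ln_lt0// la0.
(* The longer length is [K * t], so over it [2 * eta] costs half of the gain. *)
pose eta := - ln la / (4 * K%:R).
have eta0 : 0 < eta by rewrite divr_gt0 ?oppr_gt0// mulr_gt0.
have /cvgrPdist_le /(_ _ eta0) [N2 _ WN2] := Wl.
pose kappa := expR (ln la / 2).
have kappa1 : `|kappa| < 1.
  by rewrite ger0_norm ?expR_ge0// expR_lt1 pmulr_llt0.
have A1 N : 1 <= #|W N|%:R :> R by rewrite ler1n card_words_gt0.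
have A_le N : (N2 < N)%N -> #|W N|%:R <= expR ((l + eta) * N%:R).
  move=> NN; rewrite -[leLHS]lnK ?posrE; last exact: lt_le_trans (A1 N).
  rewrite ler_expR -ler_pdivrMr; last by rewrite ltr0n (leq_trans _ NN).
  by have := WN2 N (ltnW NN); rewrite /= ler_norml => /andP[]; lra.
have bound t N (g : nat) a : (N2 < N)%N -> (N <= K * t)%N ->
    g%:R <= la ^+ t * #|W N|%:R -> a <= expR (- (l - eta) * N%:R) -> 0 <= a ->
    g%:R * a <= kappa ^+ t.
  move=> N2N NK ga aN a0.
  apply: (@le_trans _ _ (la ^+ t * expR ((l + eta) * N%:R) *
      expR (- (l - eta) * N%:R))).
    apply: ler_pM => //; apply: le_trans ga _.
    by rewrite ler_wpM2l ?exprn_ge0 ?(ltW la0)// A_le.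
  rewrite -[la]lnK ?posrE// -!expRM_natl -!expRD ler_expR.
  have : eta * N%:R <= eta * (K%:R * t%:R).
    by rewrite ler_wpM2l ?(ltW eta0)// -natrM ler_nat.
  rewrite {2}/eta [leRHS](_ : _ = - ln la * t%:R / 4); last by field; rewrite gt_eqF.
  by rewrite -mulr_natl; lra.
have tends e : 0 < e -> \forall t \near \oo, kappa ^+ t < e.
  by move=> e0; apply: (@cvgr_lt R _ \oo _ _ 0) => //; exact: cvg_expr.
have horizonE t : (n jmax * horizon n jmax t = K * t)%N by rewrite /horizon /K !mulnA.
have leN0 t : (t <= (n jmax).-1 * horizon n jmax t)%N.
  by rewrite /horizon mulnA leq_pmull// !muln_gt0 Q0 -subn1 subn_gt0 M1.
have leN01 t : ((n jmax).-1 * horizon n jmax t <= n jmax * horizon n jmax t)%N.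
  by rewrite leq_mul2r leq_pred orbT.
(* If [l] were nonpositive, thin covers would have less than one element. *)
have l_gt0 : 0 < l.
  rewrite ltNge; apply/negP => l0.
  near \oo => t.
  have N2t : (N2 < t)%N by near: t; exact: nbhs_infty_gt.
  have kt : kappa ^+ t < 1 / 2 by near: t; exact: tends.
  have [G0 [G1 [h0 h1 hX]]] := thin t.
  have one_le N : 1 <= expR (- (l - eta) * N%:R).
    by rewrite -expR0 ler_expR mulr_ge0// opprB subr_ge0 (le_trans l0)// ltW.
  have lt0 := leq_trans N2t (leN0 t).
  have b0 : #|G0|%:R * 1 <= kappa ^+ t.
    by apply: bound h0 (one_le _) ler01 => //; rewrite -horizonE.
  have b1 : #|G1|%:R * 1 <= kappa ^+ t.
    apply: bound h1 (one_le _) ler01 => //; last by rewrite -horizonE.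
    exact: leq_trans (leN01 t).
  have X0 : X (of_entries (fun=> ord0)).
    apply/mult_shiftP => k k0; exists jmax.
    by rewrite entry_of_entries// muln_gt0 k0 n_pos.
  have nonempty N (G : {set {ffun 'I_N -> 'I_m.+1}}) w : w \in G -> 1 <= #|G|%:R :> R.
    by move=> wG; rewrite ler1n; apply/card_gt0P; exists w.
  have := nonempty _ G0; have := nonempty _ G1 => ne1 ne0.
  have g0 : 0 <= #|G0|%:R :> R by [].
  have g1 : 0 <= #|G1|%:R :> R by [].
  by case: (hX _ X0) => [/ne0|/ne1]; lra.
(* The exponent has to be nonnegative even if [eta] exceeds [l]. *)
pose s := Num.max 0 ((l - eta) / c).
have s0 : 0 <= s by rewrite le_max lexx.
have sc : l - eta <= s * c by rewrite -ler_pdivrMr// le_max lexx orbT.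
exists s; split.
  rewrite s0 gt_max divr_gt0//= ltr_pM2r ?invr_gt0//.
  by rewrite ltrBlDr ltrDl.
have powR_le N : powR (radius N) s <= expR (- (l - eta) * N%:R).
  rewrite /powR gt_eqF ?invr_gt0 ?exprn_gt0// ler_expR lnV ?posrE ?exprn_gt0//.
  rewrite lnXn// -/c -(mulr_natl c) -natr1.
  have : (l - eta) * N%:R <= s * c * N%:R by apply: ler_wpM2r.
  have : 0 <= s * c by rewrite mulr_ge0 ?(ltW c0).
  lra.
move=> N e e0; near \oo => t.
have N2t : (N2 < t)%N by near: t; exact: nbhs_infty_gt.
have Nt : (N < t)%N by near: t; exact: nbhs_infty_gt.
have kt : kappa ^+ t < e / 2 by near: t; apply: tends; exact: divr_gt0.
have [G0 [G1 [h0 h1 hX]]] := thin t.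
exists ((n jmax).-1 * horizon n jmax t)%N, (n jmax * horizon n jmax t)%N, G0, G1.
have Nt0 := leq_trans (ltnW Nt) (leN0 t); split=> //; first exact: leq_trans (leN01 t).
have lt0 := leq_trans N2t (leN0 t).
rewrite [e]splitr; apply: lerD.
  apply: le_trans (ltW kt); apply: bound h0 (powR_le _) (powR_ge0 _ _) => //.
  by rewrite -horizonE.
apply: le_trans (ltW kt); apply: bound h1 (powR_le _) (powR_ge0 _ _) => //.
  exact: leq_trans (leN01 t).
by rewrite -horizonE.
Unshelve. all: by end_near.
Qed.

End CoverSums.

(** * The strict inequality *)

Lemma hausdorff_dim_mult_shift_lt (R : realType) (m r : nat)
    (n : 'I_r -> nat) (l : R) :
  (0 < m)%N -> (1 < r)%N -> (forall i, (0 < n i)%N) -> injective n ->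
  ln #|words (R := R) (m := m) n N|%:R / N%:R @[N --> \oo] --> l ->
  (hausdorff_dim (mult_shift R m.+1 n) < (l / ln m.+1%:R)%:E)%E.
Proof.
move=> m0 r1 n_pos n_inj Wl.
have [s [/andP[s0 sl] covers]] := exists_thin_covers m0 r1 n_pos n_inj Wl.
apply: (@le_lt_trans _ _ s%:E); last by rewrite lte_fin.
apply: hausdorff_dim_le => // delta e d0 e0.
have [N Nd] : exists N, m.+1%:R ^- N <= delta.
  near \oo => N; exists N; rewrite -exprVn ltW//; near: N.
  apply: (@cvgr_lt R _ \oo _ _ 0) => //; apply: cvg_expr.
  by rewrite ger0_norm ?invr_ge0// invf_lt1// ltr1n.
have radius_le N' : (N <= N')%N -> m.+1%:R ^- N'.+1 <= delta.
  move=> NN; apply: le_trans Nd; rewrite lef_pV2 ?posrE ?exprn_gt0//.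
  by rewrite ler_weXn2l ?ler1n// leqW.
have [N0 [N1 [G0 [G1 [NN0 NN1 cover sum_le]]]]] := covers N e e0.
apply: le_trans (hausdorff_content_two_scales s0 (radius_le _ NN0)
  (radius_le _ NN1) cover) _.
by rewrite lee_fin.
Unshelve. all: by end_near.
Qed.

Theorem corollary2p3 (R : realType) (m r : nat) (n : 'I_r -> nat)
  (hm : (2 <= m)%N) (hr : (2 <= r)%N)
  (n_pos : forall i, (0 < n i)%N) (n_inj : injective n) :
  has_minkowski_dim (mult_shift R m n) /\
  (hausdorff_dim (mult_shift R m n) < minkowski_dim (mult_shift R m n))%E.
Proof.
case: m hm => // m m0.
have r0 : (0 < r)%N by exact: ltnW.
have /cvg_ex[/= l Wl] := cvg_ln_card_words (R := R) (m := m) n_pos r0.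
have Xl := cvg_minkowski_ratio m0 n_pos r0 Wl.
split; first by apply/cvg_ex; eexists; exact: Xl.
by rewrite /minkowski_dim (cvg_lim _ Xl)//; exact: hausdorff_dim_mult_shift_lt.
Qed.
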